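(* Let $n\ge1$ and let $\{\mathbf{s}_1,\dots,\mathbf{s}_M\}\subset\mathbb{R}^n$ be an arbitrary constellation of $M\ge2$ distinct points, used over the AWGN channel with maximum-likelihood detection. Then the derivative of the symbol error rate in the noise power satisfies, for all $P_N>0$, $$0\le\frac{dP_e}{dP_N}\le\frac{c_n}{P_N},\qquad c_n=\frac{(n/2)^{n/2}e^{-n/2}}{\Gamma(n/2)},$$ where $\Gamma$ is the gamma function.
   Context: Setting: a constellation is a set of $M\ge2$ distinct points $\mathbf{s}_1,\dots,\mathbf{s}_M\in\mathbb{R}^n$, normalized by $\frac1M\sum_{i=1}^M|\mathbf{s}_i|^2=1$ ($|\cdot|$ is the Euclidean norm). The received vector is $\mathbf{r}=\mathbf{s}+\boldsymbol{\xi}$, where $\mathbf{s}$ is a random constellation point with prior probabilities $\Pr[\mathbf{s}=\mathbf{s}_i]\ge0$ summing to 1 (not depending on the noise), and $\boldsymbol\xi\sim\mathcal N(\mathbf 0,\sigma_0^2\mathbf I)$ is independent of $\mathbf{s}$. The noise power is $P_N=\sigma_0^2>0$. The maximum-likelihood detector outputs $\hat{\mathbf{s}}=\arg\min_{\mathbf{s}_i}|\mathbf{r}-\mathbf{s}_i|$. The decision region of $\mathbf{s}_i$, with the origin shifted to $\mathbf{s}_i$, is $\Omega_i=\{\mathbf{x}\in\mathbb{R}^n:\ (\mathbf{s}_j-\mathbf{s}_i)^T\mathbf{x}\le\frac12|\mathbf{s}_j-\mathbf{s}_i|^2\ \ \forall j\ne i\}$. $P_{ci}(P_N)=\int_{\Omega_i}(2\pi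 P_N)^{-n/2}e^{-|\mathbf{x}|^2/(2P_N)}\,d\mathbf{x}$, $P_{ei}=1-P_{ci}$, $P_e=\sum_{i=1}^M P_{ei}\Pr[\mathbf{s}=\mathbf{s}_i]$. *)

(* Defs.v *)
From HB Require Import structures.
From mathcomp Require Import all_boot all_order all_algebra.
From mathcomp Require Import all_classical all_reals all_analysis.

Set Implicit Arguments.
Unset Strict Implicit.
Unset Printing Implicit Defensive.

Import Order.TTheory GRing.Theory Num.Theory.
Import numFieldNormedType.Exports.

Local Open Scope classical_set_scope.
Local Open Scope ring_scope.

(* R^n is [n.-tuple R] with its product sigma-algebra. *)

Section lebesgue_tuple.
Context {R : realType}.

Definition cons_pair n (x : measurableTypeR R * n.-tuple R) : n.+1.-tuple R :=
  [tuple of x.1 :: x.2].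

Lemma measurable_cons_pair n :
  measurable_fun [set: measurableTypeR R * n.-tuple R] (@cons_pair n).
Proof.
apply: (@measurable_cons _ _ (measurableTypeR R * n.-tuple R)%type R
  (fun x => x.1) n (fun x => x.2)).
- exact: measurable_fst.
- exact: measurable_snd.
Qed.

Section lebesgue_cons.
Variables (n : nat) (mu : {sigma_finite_measure set (n.-tuple R) -> \bar R}).

Definition lebesgue_cons : set (n.+1.-tuple R) -> \bar R :=
  pushforward (lebesgue_measure \x mu)%E (@cons_pair n).

Let lebesgue_cons0 : lebesgue_cons set0 = 0%E.
Proof. by rewrite /lebesgue_cons /pushforward preimage_set0 measure0. Qed.

Let lebesgue_cons_ge0 A : (0 <= lebesgue_cons A)%E.
Proof. by rewrite /lebesgue_cons /pushforward; exact: measure_ge0. Qed.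

Let lebesgue_cons_sigma_additive : semi_sigma_additive lebesgue_cons.
Proof.
move=> F mF tF mUF; rewrite /lebesgue_cons /pushforward preimage_bigcup.
apply: measure_semi_sigma_additive.
- by move=> k; rewrite -[X in measurable X]setTI; exact: measurable_cons_pair.
- apply/trivIsetP => /= i j _ _ ij; rewrite -preimage_setI.
  by move/trivIsetP : tF => /(_ _ _ _ _ ij) ->//; rewrite preimage_set0.
- by rewrite -preimage_bigcup -[X in measurable X]setTI;
    exact: measurable_cons_pair.
Qed.

HB.instance Definition _ := isMeasure.Build _ _ _ lebesgue_cons
  lebesgue_cons0 lebesgue_cons_ge0 lebesgue_cons_sigma_additive.

Let lebesgue_cons_sigma_finite : sigma_finite setT lebesgue_cons.
Proof.
have /sigma_finiteP[F [TF ndF Foo]] := sigma_finiteT (@lebesgue_measure R).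
have /sigma_finiteP[G [TG ndG Goo]] := sigma_finiteT mu.
pose split (t : n.+1.-tuple R) : measurableTypeR R * n.-tuple R :=
  (thead t, [tuple of behead t]).
have msplit : measurable_fun [set: n.+1.-tuple R] split.
  apply/measurable_fun_pairP; split; last exact: measurable_behead.
  exact: (@measurable_tnth _ R n.+1 ord0).
have splitK : cancel (@cons_pair n) split.
  by case=> x t; rewrite /split theadE; congr pair; exact: val_inj.
exists (fun k => split @^-1` (F k `*` G k)).
  rewrite -preimage_bigcup -[LHS](preimage_setT split); congr (_ @^-1` _).
  rewrite -setXTT TF TG predeqE => -[x y]; split.
    move=> [/= [i _ Fix] [j _ Gjy]]; exists (maxn i j) => //; split.
    - by move: x Fix; exact/subsetPset/ndF/leq_maxl.
    - by move: y Gjy; exact/subsetPset/ndG/leq_maxr.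
  by move=> [i _ []/= ? ?]; split; exists i.
move=> k; have [mF Fk] := Foo k; have [mG Gk] := Goo k; split.
  by rewrite -[X in measurable X]setTI; apply: msplit => //; exact: measurableX.
rewrite /lebesgue_cons /pushforward -comp_preimage.
rewrite (_ : _ \o _ = id) ?preimage_id; last exact/funext/splitK.
by rewrite product_measure1E// lte_mul_pinfty// ge0_fin_numE.
Qed.

HB.instance Definition _ := Measure_isSigmaFinite.Build _ _ _ lebesgue_cons
  lebesgue_cons_sigma_finite.

End lebesgue_cons.

(* Lebesgue measure on R^n: a point mass for n = 0, and lambda_(n+1) the image
   of lambda_1 \x lambda_n under R * R^n ~ R^(n+1). *)
Fixpoint lebesgue_tuple n : {sigma_finite_measure set (n.-tuple R) -> \bar R} :=
  match n with
  | 0 => @dirac _ (0.-tuple R) [tuple] R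
  | m.+1 => lebesgue_cons (lebesgue_tuple m)
  end.

End lebesgue_tuple.

Section awgn.
Context {R : realType}.

(* Euler's integral; it converges for 0 < s. *)
Definition Gamma (s : R) : R :=
  \int[lebesgue_measure]_(t in `]0, +oo[) (t `^ (s - 1) * expR (- t)).

Section euclidean.
Variable n : nat.
Implicit Types x y : n.-tuple R.

Definition dot x y : R := \sum_(k < n) tnth x k * tnth y k.

Definition enorm x : R := Num.sqrt (dot x x).

Definition vsub x y : n.-tuple R := [tuple tnth x k - tnth y k | k < n].

End euclidean.

Section constellation.
Variables (n M : nat) (s : 'I_M -> n.-tuple R).

Definition constellation :=
  injective s /\ M%:R^-1 * \sum_(i < M) enorm (s i) ^+ 2 = 1.

(* Maximum-likelihood region of [s i], with the origin shifted to [s i]: the noise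
   values x for which [s i] is a point of the constellation nearest to s i + x. *)
Definition decision_region (i : 'I_M) : set (n.-tuple R) :=
  [set x | forall j, j != i ->
     dot (vsub (s j) (s i)) x <= 2^-1 * enorm (vsub (s j) (s i)) ^+ 2].

(* Density of N(0, P I); only meaningful for 0 < P. *)
Definition noise_pdf (P : R) (x : n.-tuple R) : R :=
  (2 * pi * P) `^ (- (n%:R / 2)) * expR (- (enorm x ^+ 2 / (2 * P))).

Definition Pc (i : 'I_M) (P : R) : R :=
  \int[lebesgue_tuple n]_(x in decision_region i) noise_pdf P x.

Definition symbol_error_rate (prior : 'I_M -> R) (P : R) : R :=
  \sum_(i < M) (1 - Pc i P) * prior i.

End constellation.

Definition is_prior M (prior : 'I_M -> R) :=
  (forall i, 0 <= prior i) /\ \sum_(i < M) prior i = 1.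

Definition cn (n : nat) : R :=
  (n%:R / 2) `^ (n%:R / 2) * expR (- (n%:R / 2)) / Gamma (n%:R / 2).

End awgn.

(* Main.v *)
(* Polar coordinates are replaced by the layer-cake formula.  For h >= 0, Tonelli gives
     int_(R^n) int_(|x|^2)^oo h(t) dt dx = int_0^oo h(t) lambda_n{|x|^2 <= t} dt
   and, by scaling, lambda_n{|x|^2 <= t} = t^(n/2) V with V the volume of the unit ball.
   The choice h(t) = e^(-t) and the Gaussian integral give V = pi^(n/2) / ((n/2) Gamma(n/2)).

   Substituting x = sqrt(P) y, the noise N(0, P I) charges a decision region A with the
   N(0, I)-mass of A / sqrt(P), which decreases with P because A is star-shaped about 0;
   hence the lower bound.

   Differentiating under the integral, minus the derivative of that mass is the integral
   over A of the density times n/(2P) - |x|^2/(2P^2).  It is at most the integral over R^n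
   of the positive part, supported on the ball |x|^2 <= nP, and the layer-cake formula
   evaluates the latter: the radial integrand has the antiderivative
   t^(n/2+1) e^(-t/(2P)), whose value at t = nP yields c_n / P. *)

From HB Require Import structures.
Require Import Defs.
From mathcomp Require Import all_boot all_order all_algebra.
From mathcomp Require Import all_classical all_reals all_analysis.
From mathcomp Require Import measurable_realfun ring lra.
Set Implicit Arguments.
Unset Strict Implicit.
Unset Printing Implicit Defensive.
Import Order.TTheory GRing.Theory Num.Theory.
Import numFieldNormedType.Exports.
Local Open Scope ring_scope.
Local Open Scope classical_set_scope.

(** * Change of scale on the real line *)

Section scaling.
Context {R : realType}.
Local Open Scope ereal_scope.
Implicit Types (c : R).

(** The measure [nu] is [c] times the image of Lebesgue measure under multiplication by [c]. It
    gives ]a, b] the mass c (b/c - a/c) = b - a, so it is Lebesgue measure by uniqueness. *)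
Lemma ge0_integral_scale c (f : R -> \bar R) : (0 < c)%R ->
  measurable_fun setT f -> (forall x, 0 <= f x) ->
  \int[lebesgue_measure]_x f x = c%:E * \int[lebesgue_measure]_x f (c * x)%R.
Proof.
move=> c0 mf f0.
pose phi (x : measurableTypeR R) : measurableTypeR R := (c * x)%R.
have mphi : measurable_fun setT phi by apply: measurable_funM.
pose nu : {measure set (measurableTypeR R) -> \bar R} :=
  mscale (NngNum (ltW c0)) (pushforward (@lebesgue_measure R) phi).
pose mu' := nu mphi.
rewrite (eq_measure_integral mu').
  rewrite ge0_integral_mscale//; congr (_ * _).
  by rewrite ge0_integral_pushforward// preimage_setT.
move=> A mA _; apply: lebesgue_measure_unique => // _ [[a b] _ <-].
transitivity (c%:E * lebesgue_measure (`](a / c)%R, (b / c)%R]%classic : set (measurableTypeR R))).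
  rewrite !lebesgue_measure_itv/= !lte_fin ltr_pM2r ?invr_gt0//.
  case: ifPn => _; last by rewrite mule0.
  by rewrite -!EFinB -EFinM -mulrBl mulrC divfK// gt_eqF.
congr (_ * lebesgue_measure _).
apply/seteqP; split => x/=; rewrite !in_itv/= /phi ltr_pdivrMr// ler_pdivlMr//;
  by rewrite mulrC.
Qed.
End scaling.

(** * Tonelli, scaling and the Gaussian integral on R^n, by induction on n *)

Section cons.
Context {R : realType}.
Local Open Scope ereal_scope.

Lemma ge0_integral_lebesgue_cons n (f : n.+1.-tuple R -> \bar R) :
  measurable_fun setT f -> (forall x, 0 <= f x) ->
  \int[lebesgue_tuple n.+1]_x f x =
  \int[lebesgue_measure]_x \int[lebesgue_tuple n]_t f (cons_pair (x, t)).
Proof.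
move=> mf f0; rewrite /= /lebesgue_cons ge0_integral_pushforward//;
  last exact: measurable_cons_pair.
rewrite preimage_setT fubini_tonelli1//.
- by apply: measurableT_comp => //; exact: measurable_cons_pair.
- by move=> x; exact: f0.
Qed.

Definition tuple_scale n (c : R) (x : n.-tuple R) : n.-tuple R :=
  [tuple of map ( *%R c) x].

Lemma measurable_tuple_scale n (c : R) : measurable_fun setT (@tuple_scale n c).
Proof.
apply/measurable_fun_tnthP => i.
rewrite (_ : _ \o _ = fun x => c * tnth x i)%R.
  by apply: measurable_funM => //; exact: measurable_tnth.
by apply/funext => x; rewrite /= tnth_map.
Qed.

Lemma tuple_scale_cons n (c x : R) (t : n.-tuple R) :
  tuple_scale c (cons_pair (x, t)) = cons_pair ((c * x)%R, tuple_scale c t).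
Proof. exact: val_inj. Qed.

Lemma measurable_cons_pairr n (x : R) :
  measurable_fun setT (fun t : n.-tuple R => cons_pair (x, t)).
Proof. by apply: measurableT_comp; [exact: measurable_cons_pair|exact: pair1_measurable]. Qed.

Lemma measurable_fun_integral_cons n (f : n.+1.-tuple R -> \bar R) :
  measurable_fun setT f -> (forall x, 0 <= f x) ->
  measurable_fun setT (fun x : measurableTypeR R => \int[lebesgue_tuple n]_t f (cons_pair (x, t))).
Proof.
move=> mf f0.
apply: (@measurable_fun_fubini_tonelli_F _ _ _ _ _ (lebesgue_tuple n) (f \o @cons_pair R n)) => //.
- by apply: measurableT_comp => //; exact: measurable_cons_pair.
- by move=> x; exact: f0.
Qed.

(** Each coordinate split off by Tonelli contributes one factor [c]. For n = 0 the empty tuple is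
    the only point, and scaling fixes it. *)
Lemma ge0_integral_tuple_scale n c (f : n.-tuple R -> \bar R) : (0 < c)%R ->
  measurable_fun setT f -> (forall x, 0 <= f x) ->
  \int[lebesgue_tuple n]_x f x = (c ^+ n)%:E * \int[lebesgue_tuple n]_x f (tuple_scale c x).
Proof.
move=> c0; elim: n f => [|n IH] f mf f0.
  rewrite expr0 mul1e; apply: eq_integral => x _; congr f.
  by rewrite [RHS]tuple0 [LHS]tuple0.
have mfc : measurable_fun setT (f \o tuple_scale c).
  by apply: measurableT_comp => //; exact: measurable_tuple_scale.
have mcons g x : measurable_fun setT g ->
    measurable_fun setT (fun t : n.-tuple R => g (cons_pair (x, t)) : \bar R).
  by move=> mg; exact: (measurableT_comp mg (@measurable_cons_pairr n x)).
rewrite !ge0_integral_lebesgue_cons//.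
rewrite (@ge0_integral_scale _ c)//; last 2 first.
- exact: measurable_fun_integral_cons.
- by move=> x; exact: integral_ge0.
rewrite exprS EFinM -muleA; congr (_ * _).
rewrite -ge0_integralZl//; last 3 first.
- by apply: (@measurable_fun_integral_cons n (f \o tuple_scale c)) => // x; exact: f0.
- by move=> x _; exact: integral_ge0.
- by rewrite lee_fin exprn_ge0// ltW.
apply: eq_integral => x _; rewrite IH//; last exact: mcons.
by under eq_integral do rewrite -tuple_scale_cons.
Qed.

Lemma integral_gauss (b : R) : (0 < b)%R ->
  \int[lebesgue_measure]_x (expR (- (x ^+ 2 / b)))%:E = (Num.sqrt (pi * b))%:E.
Proof.
move=> b0; have sb0 : (0 < Num.sqrt b)%R by rewrite sqrtr_gt0.
rewrite (@ge0_integral_scale _ (Num.sqrt b))//.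
- under eq_integral do rewrite exprMn sqr_sqrtr ?ltW// mulrAC divff ?gt_eqF// mul1r.
  by rewrite integralT_gauss -EFinM sqrtrM ?pi_ge0// mulrC.
- apply/measurable_EFinP/measurableT_comp => //; apply: measurableT_comp => //.
  by apply: measurable_funM => //; exact: measurable_funX.
Qed.

Lemma measurable_dot n (y : n.-tuple R) : measurable_fun setT (dot y).
Proof.
apply: measurable_sum => i; apply: measurable_funM => //; exact: measurable_tnth.
Qed.

Lemma measurable_dotxx n : measurable_fun setT (fun x : n.-tuple R => dot x x).
Proof.
apply: measurable_sum => i; apply: measurable_funM => //; exact: measurable_tnth.
Qed.

Lemma dotxx_ge0 n (x : n.-tuple R) : (0 <= dot x x)%R.
Proof. by apply: sumr_ge0 => i _; rewrite -expr2 sqr_ge0. Qed.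

Lemma dot_cons n (x : R) (t : n.-tuple R) :
  (dot (cons_pair (x, t)) (cons_pair (x, t)) = x ^+ 2 + dot t t)%R.
Proof.
rewrite /dot big_ord_recl; congr (_ + _)%R.
by apply: eq_bigr => i _; rewrite tnthS.
Qed.

Lemma dot_scale n c (x y : n.-tuple R) : dot x (tuple_scale c y) = (c * dot x y)%R.
Proof. by rewrite /dot mulr_sumr; apply: eq_bigr => i _; rewrite tnth_map mulrCA. Qed.

Lemma dotC n (x y : n.-tuple R) : dot x y = dot y x.
Proof. by apply: eq_bigr => i _; rewrite mulrC. Qed.

Lemma dotxx_scale n c (x : n.-tuple R) :
  dot (tuple_scale c x) (tuple_scale c x) = (c ^+ 2 * dot x x)%R.
Proof. by rewrite dot_scale dotC dot_scale mulrA expr2. Qed.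

Lemma integral_gauss_tuple n (b : R) : (0 < b)%R ->
  \int[lebesgue_tuple n]_x (expR (- (dot x x / b)))%:E = ((pi * b) `^ (n%:R / 2))%:E.
Proof.
move=> b0; have mE m : measurable_fun setT (fun x : m.-tuple R => (expR (- (dot x x / b)))%:E).
  apply/measurable_EFinP/measurableT_comp => //; apply: measurableT_comp => //.
  by apply: measurable_funM => //; exact: measurable_dotxx.
elim: n => [|n IH].
  (* For n = 0 the measure is a point mass and the empty sum in the exponent is 0, so both sides are
     1. *)
  rewrite mul0r powRr0 /= integral_dirac//; last exact: (mE 0%N).
  by rewrite diracE in_setT mul1e /dot big_ord0 mul0r oppr0 expR0.
rewrite ge0_integral_lebesgue_cons//.
under eq_integral => x _.
  under eq_integral => t _ do rewrite dot_cons mulrDl opprD expRD EFinM.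
  rewrite ge0_integralZl//; last exact: mE.
  rewrite IH; over.
have mg : measurable_fun setT (fun x : R => (expR (- (x ^+ 2 / b)))%:E).
  apply/measurable_EFinP/measurableT_comp => //; apply: measurableT_comp => //.
  by apply: measurable_funM => //; exact: measurable_funX.
rewrite ge0_integralZr//; last by rewrite lee_fin powR_ge0.
rewrite integral_gauss// -EFinM; congr EFin.
rewrite -powR12_sqrt; last by rewrite mulr_ge0 ?pi_ge0 ?ltW.
rewrite -powRD; last by rewrite (gt_eqF (mulr_gt0 _ _)) ?pi_gt0// implybT.
by congr (_ `^ _)%R; rewrite -natr1; field.
Qed.

End cons.

(** * The layer-cake formula *)

Section layer_cake.
Context {R : realType} d (X : measurableType d).
Variable mu : {sigma_finite_measure set X -> \bar R}.
Local Open Scope ereal_scope.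
Local Notation leb := (@lebesgue_measure R).

(** Both sides integrate [w x * h t] over the pairs with [q x <= t], in the two orders of Tonelli.
    The weight lets one formula serve both R^n, with w = 1, and the half-line, where w is the
    density a s^(a-1). *)
Lemma layer_cake (w : X -> \bar R) (q : X -> R) (h : R -> \bar R) :
  measurable_fun [set: X] w -> (forall x, 0 <= w x) ->
  measurable_fun [set: X] q ->
  measurable_fun [set: R] h -> (forall t, 0 <= h t) ->
  \int[mu]_x (w x * \int[leb]_(t in `[q x, +oo[) h t) =
  \int[leb]_t (h t * \int[mu]_(x in [set x | (q x <= t)%R]) w x).
Proof.
move=> mw w0 mq mh h0.
pose F (z : X * measurableTypeR R) : \bar R := if (q z.1 <= z.2)%R then w z.1 * h z.2 else 0.
have mF : measurable_fun [set: X * measurableTypeR R] F.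
  apply: measurable_fun_ifT => //.
    apply: measurable_fun_ler; [exact: measurableT_comp|exact: measurable_snd].
  apply: emeasurable_funM; first exact: measurableT_comp.
  by apply: (@measurableT_comp _ _ _ _ _ _ h).
have F0 z : 0 <= F z by rewrite /F; case: ifP => // _; exact: mule_ge0.
transitivity (\int[mu]_x \int[leb]_t F (x, t)).
  apply: eq_integral => x _.
  rewrite -ge0_integralZl//; last exact: measurable_funTS.
  rewrite integral_mkcond; apply: eq_integral => t _.
  rewrite patchE mem_setE in_itv/= andbT /F/=.
  by case: ifP.
rewrite (fubini_tonelli F)//.
apply: eq_integral => t _.
have mq' : measurable [set x | (q x <= t)%R].
  by rewrite -[X in measurable X]setTI; exact: measurable_fun_le.
rewrite -ge0_integralZl//; last exact: measurable_funTS.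
rewrite [RHS]integral_mkcond; apply: eq_integral => x _.
rewrite patchE /F/= muleC.
case: (boolP (q x <= t)%R) => qxt; first by rewrite mem_set.
by rewrite memNset//=; exact/negP.
Qed.
End layer_cake.

(** * Powers as integrals of their derivatives *)

Section power.
Context {R : realType}.
Local Open Scope ereal_scope.
Local Notation leb := (@lebesgue_measure R).

Lemma continuous_powR (a x : R) : (0 < x)%R -> {for x, continuous (fun y : R => y `^ a)}%R.
Proof.
move=> x0; apply/differentiable_continuous/derivable1_diffP.
by apply: derivable_powR; rewrite in_itv/= andbT.
Qed.

(** When a < 1 the integrand is unbounded near 0. The fundamental theorem of calculus is therefore
    applied on [e_k, t], and monotone convergence lets e_k tend to 0. *)
Lemma integral_powR_oc (a t : R) : (0 < a)%R -> (0 < t)%R ->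
  \int[leb]_(s in `]0%R, t]) (a * s `^ (a - 1))%:E = (t `^ a)%:E.
Proof.
move=> a0 t0.
(* Dividing by k + 2 rather than k + 1 keeps e_0 < t, so no interval is degenerate. *)
pose e k : R := (t / k.+2%:R)%R.
have e0 k : (0 < e k)%R by rewrite divr_gt0.
have et k : (e k < t)%R by rewrite ltr_pdivrMr// ltr_pMr// ltr1n.
have eE : \bigcup_k `[e k, t] = `]0%R, t].
  apply/seteqP; split => [x [k _]|x]/=; rewrite !in_itv/= => /andP[].
    by move=> ex ->; rewrite (lt_le_trans (e0 k) ex).
  (* With k the integer part of t / x, one has t / x < k + 1 < k + 2, hence e_k < x. *)
  move=> x0 xt; exists (Num.truncn (t / x)) => //=.
  rewrite in_itv/= xt andbT /e ler_pdivrMr// mulrC -ler_pdivrMr//.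
  by rewrite ltW// (lt_trans (truncnS_gt _))// ltr_nat.
have mf : measurable_fun [set: R] (fun s : R => (a * s `^ (a - 1))%:E).
  by apply/measurable_EFinP/measurable_funM => //; exact: measurable_powR.
have nd : nondecreasing_seq (fun k => `[e k, t]).
  move=> m n mn; apply/subsetPset => x /=; rewrite !in_itv/= => /andP[ex ->].
  rewrite andbT (le_trans _ ex)// ler_pM2l// lef_pV2 ?posrE//.
  by rewrite ler_nat !ltnS.
have fE k : \int[leb]_(s in `[e k, t]) (a * s `^ (a - 1))%:E = (t `^ a)%:E - (e k `^ a)%:E.
  have cP x : (0 < x)%R -> {for x, continuous (fun s : R => a * s `^ (a - 1))%R}.
    by move=> x0; apply: cvgM; [exact: cvg_cst|exact: continuous_powR].
  apply: (@continuous_FTC2 _ _ (fun s => s `^ a)%R) => //.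
  - apply: continuous_in_subspaceT => x; rewrite inE/= in_itv/= => /andP[ex _].
    by apply: cP; exact: lt_le_trans ex.
  - split.
    + move=> x; rewrite in_itv/= => /andP[ex _]; apply: derivable_powR.
      by rewrite in_itv/= andbT (lt_trans (e0 k)).
    + by apply: cvg_at_right_filter; exact: continuous_powR.
    + by apply: cvg_at_left_filter; exact: continuous_powR.
  - move=> x; rewrite in_itv/= => /andP[ex _]; apply: powR_derive1.
    by rewrite in_itv/= andbT (lt_trans (e0 k)).
(* The integrals in [fE] converge to the integral over the union ]0, t]; by uniqueness of limits it
   remains to see that e_k^a tends to 0. *)
have := @ge0_nondecreasing_set_cvg_integral _ (measurableTypeR R) R
  (fun k => `[e k, t]) (fun s : R => (a * s `^ (a - 1))%:E) leb nd
  (fun=> measurable_itv _) (fun=> measurable_funTS mf).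
rewrite eE => /(_ _)/cvg_unique; apply => //.
  by move=> k x _; rewrite lee_fin mulr_ge0 ?powR_ge0// ltW.
rewrite [X in X @ _](_ : _ = (fun k => (t `^ a - e k `^ a)%:E)); last first.
  by apply/funext => k; exact: fE.
apply: cvg_EFin; first exact: nearW.
rewrite -[X in _ --> X]subr0; apply: cvgB; first exact: cvg_cst.
have /cvg_at_rightP := powR_cvg0 a0; apply.
split => //.
rewrite -[X in _ --> X](mulr0 t); apply: cvgM; first exact: cvg_cst.
have := @cvg_harmonic R.
by rewrite -cvg_shiftS.
Qed.
End power.

(** * Integrals of radial functions *)

Section radial.
Context {R : realType}.
Local Open Scope ereal_scope.
Local Notation leb := (@lebesgue_measure R).

(** The point 0 is left free: it is a null set, and the formulas in t^a to which this is applied are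
    proved for t > 0 only. *)
Lemma integral_gt0_supp (k k' : R -> \bar R) :
  (forall t, (t < 0)%R -> k t = 0) -> (forall t, (0 < t)%R -> k t = k' t) ->
  measurable_fun [set: R] k' ->
  \int[leb]_t k t = \int[leb]_(t in `]0%R, +oo[) k' t.
Proof.
move=> kN kP mk'.
have mk : measurable_fun (`]0%R, +oo[ : set R) k.
  apply: (eq_measurable_fun k'); last exact: measurable_funTS.
  by move=> t; rewrite inE/= in_itv/= andbT => /kP ->.
transitivity (\int[leb]_(t in `[0%R, +oo[) k t).
  rewrite [RHS]integral_mkcond; apply: eq_integral => t _.
  rewrite patchE mem_setE in_itv/= andbT.
  by case: leP => // /kN.
rewrite -integral_itv_obnd_cbnd//; apply: eq_integral => t.
by rewrite inE/= in_itv/= andbT => /kP.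
Qed.

Lemma ball_measurable n (t : R) : measurable [set x : n.-tuple R | (dot x x <= t)%R].
Proof.
by rewrite -[X in measurable X]setTI; apply: measurable_fun_le => //; exact: measurable_dotxx.
Qed.

(** The change of scale by sqrt(t) carries the unit ball to this ball, with Jacobian sqrt(t)^n =
    t^(n/2). *)
Lemma lebesgue_tuple_ball n (t : R) : (0 < t)%R ->
  lebesgue_tuple n [set x | (dot x x <= t)%R] =
  (t `^ (n%:R / 2))%:E * lebesgue_tuple n [set x | (dot x x <= 1)%R].
Proof.
move=> t0; have st0 : (0 < Num.sqrt t)%R by rewrite sqrtr_gt0.
have E (u : R) : lebesgue_tuple n [set x | (dot x x <= u)%R] =
    \int[lebesgue_tuple n]_x (\1_[set x : n.-tuple R | (dot x x <= u)%R] x)%:E.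
  by rewrite integral_indic ?setIT//; exact: ball_measurable.
rewrite !E (ge0_integral_tuple_scale st0); last 2 first.
- by apply/measurable_EFinP; apply: measurable_indic; exact: ball_measurable.
- by move=> x; rewrite lee_fin.
congr (_ * _).
  by rewrite -powR12_sqrt ?ltW// -powR_mulrn ?powR_ge0// -powRrM mulrC.
apply: eq_integral => x _; congr EFin; rewrite !indicE; congr (nat_of_bool _)%:R.
have E2 : (dot (tuple_scale (Num.sqrt t) x) (tuple_scale (Num.sqrt t) x) <= t)%R = (dot x x <= 1)%R.
  by rewrite dotxx_scale sqr_sqrtr ?(ltW t0)// ger_pMr.
by apply/idP/idP => /set_mem xt; apply/mem_set; move: xt; rewrite /mkset E2.
Qed.

(** Layer cake with weight 1 and q = |x|^2, followed by the homogeneity of the volume of balls. A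
    radial integrand enters through its expression as a tail integral. *)
Lemma ge0_integral_radial n (h : R -> \bar R) :
  measurable_fun [set: R] h -> (forall t, 0 <= h t) ->
  \int[lebesgue_tuple n]_x \int[leb]_(t in `[dot x x, +oo[) h t =
  lebesgue_tuple n [set x | (dot x x <= 1)%R] *
  \int[leb]_(t in `]0%R, +oo[) (h t * (t `^ (n%:R / 2))%:E).
Proof.
move=> mh h0.
have mp : measurable_fun [set: R] (fun t => h t * (t `^ (n%:R / 2))%:E).
  by apply: emeasurable_funM => //; apply/measurable_EFinP; exact: measurable_powR.
transitivity (\int[lebesgue_tuple n]_x (cst 1 x * \int[leb]_(t in `[dot x x, +oo[) h t)).
  by apply: eq_integral => x _; rewrite mul1e.
rewrite layer_cake//; last exact: measurable_dotxx.
transitivity (\int[leb]_t (h t * lebesgue_tuple n [set x | (dot x x <= t)%R])).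
  by apply: eq_integral => t _; rewrite integral_cst ?mul1e//; exact: ball_measurable.
rewrite -ge0_integralZl//; last 2 first.
- exact: measurable_funTS.
- by move=> t _; rewrite mule_ge0// lee_fin powR_ge0.
apply: integral_gt0_supp.
- move=> t t0; rewrite (_ : [set x | _] = set0) ?measure0 ?mule0//.
  rewrite -subset0 => x /=; apply/negP; rewrite -ltNge.
  exact: (lt_le_trans t0 (dotxx_ge0 x)).
- by move=> t t0; rewrite lebesgue_tuple_ball// muleA muleC.
- exact: measurable_funeM.
Qed.

(** Layer cake on the half-line, with q the identity and weight a s^(a-1), whose integral over ]0,
    t] is t^a. For h(t) = e^(-t) it is the identity a Gamma(a) = Gamma(a + 1), obtained without
    integration by parts. *)
Lemma ge0_integral_powR_tail (a : R) (h : R -> \bar R) : (0 < a)%R ->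
  measurable_fun [set: R] h -> (forall t, 0 <= h t) ->
  \int[leb]_(s in `]0%R, +oo[) ((a * s `^ (a - 1))%:E * \int[leb]_(t in `[s, +oo[) h t) =
  \int[leb]_(t in `]0%R, +oo[) (h t * (t `^ a)%:E).
Proof.
move=> a0 mh h0.
pose f (s : R) := (a * s `^ (a - 1))%:E.
have mf : measurable_fun [set: R] f.
  by apply/measurable_EFinP/measurable_funM => //; exact: measurable_powR.
have f0 s : 0 <= f s by rewrite lee_fin mulr_ge0 ?powR_ge0// ltW.
pose w : R -> \bar R := f \_ `]0%R, +oo[.
have w0 s : 0 <= w s by apply: erestrict_ge0 => x _; exact: f0.
have mw : measurable_fun [set: R] w.
  by apply/measurable_restrict => //; exact: measurable_funTS.
transitivity (\int[leb]_s (w s * \int[leb]_(t in `[s, +oo[) h t)).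
  rewrite integral_mkcond; apply: eq_integral => s _.
  by rewrite /w !patchE; case: ifP => // _; rewrite mul0e.
rewrite (@layer_cake _ _ (measurableTypeR R) leb w id h)//.
apply: integral_gt0_supp.
- move=> t t0; rewrite integral0_eq ?mule0// => x /= xt.
  by rewrite /w patchE memNset//= in_itv/= andbT; apply/negP; rewrite -leNgt (le_trans xt)// ltW.
- move=> t t0; congr (_ * _).
  rewrite -(integral_powR_oc a0 t0) -integral_mkcondr; congr (integral _ _ _).
  apply/seteqP; split => x /=; rewrite !in_itv/= andbT.
    by move=> [-> ->].
  by move=> /andP[-> ->].
- by apply: emeasurable_funM => //; apply/measurable_EFinP; exact: measurable_powR.
Qed.

End radial.

(** * Volume of the unit ball *)

Section volume.
Context {R : realType}.
Local Open Scope ereal_scope.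
Local Notation leb := (@lebesgue_measure R).

Lemma is_derive_expRN (r x : R) :
  is_derive x 1%R (fun t => expR (- (r * t)))%R (- r * expR (- (r * x)))%R.
Proof.
have -> : (fun t : R => expR (- (r * t)))%R = expR \o (fun t => - r * t)%R.
  by apply/funext => t /=; rewrite mulNr.
have dl : is_derive x 1%R (fun t => - r * t)%R (- r)%R.
  by apply: is_derive_eq; rewrite /GRing.scale/=; ring.
apply: (is_derive_eq (is_derive1_comp (is_derive_expR _) dl)). by rewrite mulrC !mulNr.
Qed.

Lemma integral_expRN_tail (u : R) :
  \int[leb]_(t in `[u, +oo[) (expR (- t))%:E = (expR (- u))%:E.
Proof.
have dF (x : R) : is_derive x 1%R (fun t : R => - expR (- t))%R (expR (- x)).
  have := is_derive_expRN 1 x.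
  under eq_fun do rewrite mul1r.
  by move=> d; apply: is_derive_eq; rewrite mul1r mulN1r opprK.
rewrite (@ge0_continuous_FTC2y _ (fun t => expR (- t))%R (fun t => - expR (- t))%R u 0%R).
- by rewrite add0e EFinN oppeK.
- by move=> x _; exact: expR_ge0.
- apply: continuous_subspaceT => x.
  by apply: continuous_comp; [exact: opp_continuous|exact: continuous_expR].
- rewrite -oppr0; apply: cvgN; exact: cvgr_expR.
- by move=> x _; exact: ex_derive.
- apply: cvg_at_right_filter; apply: cvgN.
  by apply: continuous_comp; [exact: opp_continuous|exact: continuous_expR].
- by move=> x _; rewrite derive1E; exact: derive_val.
Qed.

Definition ball_volume (n : nat) : \bar R := lebesgue_tuple n [set x | (dot x x <= 1)%R].

(** The integral of e^(-|x|^2) is computed twice: as a product of Gaussian integrals it is pi^(n/2),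
    and as a radial integral it is the volume times a Gamma(a), with a = n/2. Convergence and
    positivity of Euler's integral come out of the same equation. *)
Lemma ball_volumeE (n : nat) : (0 < n)%N ->
  (0 < Gamma (n%:R / 2 : R))%R /\
  ball_volume n = (pi `^ (n%:R / 2) / (n%:R / 2 * Gamma (n%:R / 2)))%:E.
Proof.
move=> n0; set a : R := (n%:R / 2)%R.
have a0 : (0 < a)%R by rewrite divr_gt0// ltr0n.
have mexp : measurable_fun [set: R] (fun t : R => (expR (- t))%:E).
  by apply/measurable_EFinP/measurableT_comp => //; exact: measurableT_comp.
have e0 (t : R) : 0 <= (expR (- t))%:E by rewrite lee_fin expR_ge0.
pose G := \int[leb]_(s in `]0%R, +oo[) (s `^ (a - 1) * expR (- s))%:E.
have mG : measurable_fun [set: R] (fun s : R => (s `^ (a - 1) * expR (- s))%:E).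
  apply/measurable_EFinP/measurable_funM; first exact: measurable_powR.
  by apply: measurableT_comp => //; exact: measurableT_comp.
have piE : (pi `^ a)%:E = ball_volume n * (a%:E * G).
  rewrite -[in LHS](mulr1 pi) -integral_gauss_tuple//.
  under eq_integral do rewrite divr1 -integral_expRN_tail.
  rewrite ge0_integral_radial// -(ge0_integral_powR_tail a0)//; congr (_ * _).
  rewrite /G -ge0_integralZl//; last 3 first.
  - exact: measurable_funTS.
  - by move=> s _; rewrite lee_fin mulr_ge0 ?powR_ge0 ?expR_ge0.
  - by rewrite lee_fin ltW.
  by apply: eq_integral => s _; rewrite integral_expRN_tail -!EFinM mulrA.
have pia0 : (0 < pi `^ a :> R)%R by rewrite powR_gt0// pi_gt0.
have G0 : 0 <= G by apply: integral_ge0 => s _; rewrite lee_fin mulr_ge0 ?powR_ge0 ?expR_ge0.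
have V0 : 0 <= ball_volume n by exact: measure_ge0.
have GE : Gamma a = fine G by [].
(* The product of the volume, a and G is the positive real pi^a. As 0 times infinity is 0 here,
   neither the volume nor G can be infinite, and G cannot vanish. *)
move: piE; rewrite GE; move: G G0 {GE} => [g| |]//; last first.
  move=> _; rewrite gt0_muley ?lte_fin//.
  move: V0; rewrite le_eqVlt => /predU1P[<-|V0]; last by rewrite gt0_muley.
  by rewrite mul0e => -[] /eqP; rewrite gt_eqF.
rewrite lee_fin le_eqVlt => /predU1P[<-|g0].
  by rewrite !mule0 => -[] /eqP; rewrite gt_eqF.
rewrite -EFinM; have ag0 : (0 < a * g)%R by rewrite mulr_gt0.
move: (ball_volume n) V0 => [v| |]// v0; last by rewrite gt0_mulye.
move=> [->]; split => //=; congr EFin.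
by rewrite mulfK// gt_eqF.
Qed.
End volume.

(** * Antiderivatives on closed intervals *)

Section FTC.
Context {R : realType}.
Local Open Scope ereal_scope.
Local Notation leb := (@lebesgue_measure R).

(** The derivative is required in the open interval only, since an antiderivative containing a real
    power of t will be used down to the endpoint 0. *)
Lemma integral_is_derive (f F : R -> R) (a b : R) : (a < b)%R ->
  {within `[a, b], continuous f} -> {within `[a, b], continuous F} ->
  (forall x, (a < x < b)%R -> is_derive x 1%R F (f x)) ->
  \int[leb]_(x in `[a, b]) (f x)%:E = (F b - F a)%:E.
Proof.
move=> ab cf /(continuous_within_itvP _ ab)[_ Fa Fb] dF.
rewrite EFinB; apply: continuous_FTC2 => //.
  by split => // x; rewrite in_itv/= => /dF ?; exact: ex_derive.
by move=> x; rewrite in_itv/= => /dF ?; rewrite derive1E; exact: derive_val.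
Qed.

Lemma within_continuous_powR (a c : R) : (0 < a)%R -> (0 < c)%R ->
  {within `[0%R, c], continuous (fun t : R => t `^ a)}%R.
Proof.
move=> a0 c0; apply/continuous_within_itvP => //; split.
- by move=> x; rewrite in_itv/= => /andP[x0 _]; exact: continuous_powR.
- by rewrite powR0 ?gt_eqF//; exact: powR_cvg0.
- by apply: cvg_at_left_filter; exact: continuous_powR.
Qed.

Lemma within_continuousM (A : set R) (f g : R -> R) :
  {within A, continuous f} -> {within A, continuous g} ->
  {within A, continuous (fun t => f t * g t)%R}.
Proof. by move=> cf cg /= z; apply: continuousM; [exact: cf|exact: cg]. Qed.

End FTC.

(** * The radial profile cut off at c *)

Section truncated.
Context {R : realType}.
Local Open Scope ereal_scope.
Local Notation leb := (@lebesgue_measure R).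
Variables (c r : R).
Hypothesis r0 : (0 < r)%R.

(* Minus the derivative of (c - t) e^(-rt), cut off at c. *)
Definition trunc_density (t : R) : R :=
  (if t <= c then (1 + (c - t) * r) * expR (- (r * t)) else 0)%R.

Lemma trunc_density_ge0 t : (0 <= trunc_density t)%R.
Proof.
rewrite /trunc_density; case: ifPn => // tc; rewrite mulr_ge0 ?expR_ge0//.
by rewrite addr_ge0// mulr_ge0 ?subr_ge0// ltW.
Qed.

Lemma measurable_trunc_density : measurable_fun [set: R] trunc_density.
Proof.
apply: measurable_fun_ifT => //; first exact: measurable_fun_ler.
apply: measurable_funM.
  apply: measurable_funD => //; apply: measurable_funM => //.
  by apply: measurable_funB.
by apply: measurableT_comp => //; apply: measurableT_comp => //; apply: measurable_funM.
Qed.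

(** On [u, c] the antiderivative -(c - t) e^(-rt) vanishes at c; for u > c the tail is zero. This
    writes the positive part of c - |x|^2, times e^(-r|x|^2), in the form that [ge0_integral_radial]
    accepts. *)
Lemma integral_trunc_density_tail (u : R) :
  \int[leb]_(t in `[u, +oo[) (trunc_density t)%:E =
  (Num.max 0 (c - u) * expR (- (r * u)))%:E.
Proof.
have dE := @is_derive_expRN R r.
transitivity (\int[leb]_(t in `[u, c]) ((1 + (c - t) * r) * expR (- (r * t)))%:E).
  rewrite integral_mkcond [RHS]integral_mkcond; apply: eq_integral => t _.
  rewrite !patchE !mem_setE !in_itv/= andbT /trunc_density.
  by case: (u <= t)%R => //=; case: ifPn.
have [cu|uc|cu] := ltgtP c u.
- rewrite set_itv_ge ?integral_set0; last by rewrite bnd_simp -ltNge.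
  by rewrite max_l ?mul0r// subr_le0 ltW.
- apply: etrans (@integral_is_derive _ _
    (fun t => - (c - t) * expR (- (r * t)))%R _ _ uc _ _ _) _; last 1 first.
  + by rewrite subrr oppr0 mul0r add0r mulNr opprK max_r// subr_ge0 ltW.
  + by apply: derivable_within_continuous => x _; exact: ex_derive.
  + by apply: derivable_within_continuous => x _; exact: ex_derive.
  + by move=> x _; apply: is_derive_eq; rewrite /GRing.scale/=; ring.
- rewrite cu set_itv1 integral_set1 subrr.
  by rewrite maxxx mul0r.
Qed.

(** The condition c r = a turns the integrand into (a + 1 - rt) t^a e^(-rt), the exact derivative of
    t^(a+1) e^(-rt). *)
Lemma integral_trunc_density_powR (a : R) : (0 < c)%R -> (0 < a)%R -> (c * r = a)%R ->
  \int[leb]_(t in `]0%R, +oo[) ((trunc_density t)%:E * (t `^ a)%:E) =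
  (c `^ (a + 1) * expR (- a))%:E.
Proof.
move=> c0 a0 cr; have dE := @is_derive_expRN R r.
transitivity (\int[leb]_(t in `[0%R, c]) ((1 + (c - t) * r) * expR (- (r * t)) * t `^ a)%:E).
  rewrite -integral_itv_obnd_cbnd; last first.
    apply/measurable_EFinP/measurable_funTS/measurable_funM; last exact: measurable_powR.
    apply: measurable_funM.
      apply: measurable_funD => //; apply: measurable_funM => //.
      by apply: measurable_funB.
    by apply: measurableT_comp => //; apply: measurableT_comp => //; apply: measurable_funM.
  rewrite integral_mkcond [RHS]integral_mkcond; apply: eq_integral => t _.
  rewrite !patchE !mem_setE !in_itv/= andbT /trunc_density.
  by case: (0 < t)%R => //=; case: ifPn => // _; rewrite mul0e.
apply: etrans (@integral_is_derive _ _
  (fun t => t `^ (a + 1) * expR (- (r * t)))%R _ _ c0 _ _ _) _; last 1 first.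
- rewrite powR0 ?mul0r ?subr0; last by rewrite gt_eqF// addr_gt0.
  by rewrite mulrC [in X in expR X]mulrC cr mulrC.
- apply: within_continuousM; last exact: within_continuous_powR.
  by apply: derivable_within_continuous => y _; exact: ex_derive.
- apply: within_continuousM; first by apply: within_continuous_powR => //; exact: addr_gt0.
  by apply: derivable_within_continuous => y _; exact: ex_derive.
- move=> x /andP[x0 xc]; have dp := is_derive1_powR (a + 1) x0.
  apply: is_derive_eq; rewrite /GRing.scale/= addrK.
  have -> : (x `^ (a + 1) = x * x `^ a)%R.
    rewrite powRD; last by rewrite (gt_eqF x0) implybT.
    by rewrite (powRr1 (ltW x0)) mulrC.
  by rewrite -cr; ring.
Qed.

End truncated.

(** * The Gaussian density and its derivative in the noise power *)

Section pdf.
Context {R : realType} (n : nat).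
Implicit Types (P : R) (x : n.-tuple R).

Lemma enorm_sqr x : enorm x ^+ 2 = dot x x.
Proof. by rewrite sqr_sqrtr// dotxx_ge0. Qed.

Lemma noise_pdf_ge0 P x : 0 <= noise_pdf P x.
Proof. by rewrite mulr_ge0 ?powR_ge0 ?expR_ge0. Qed.

Lemma measurable_gauss_tuple (b : R) :
  measurable_fun setT (fun x : n.-tuple R => expR (- (dot x x / b))).
Proof.
apply: measurableT_comp => //; apply: measurableT_comp => //.
by apply: measurable_funM => //; exact: measurable_dotxx.
Qed.

Lemma measurable_noise_pdf P : measurable_fun setT (@noise_pdf R n P).
Proof.
apply: measurable_funM => //.
rewrite (_ : (fun x => _) = fun x : n.-tuple R => expR (- (dot x x / (2 * P)))).
  exact: measurable_gauss_tuple.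
by apply/funext => x; rewrite enorm_sqr.
Qed.

Lemma integrable_gauss_tuple (b : R) : 0 < b ->
  (lebesgue_tuple n).-integrable setT (fun x => (expR (- (dot x x / b)))%:E).
Proof.
move=> b0; apply/integrableP; split.
  by apply/measurable_EFinP; exact: measurable_gauss_tuple.
under eq_integral do rewrite gee0_abs ?lee_fin ?expR_ge0//.
by rewrite integral_gauss_tuple// ltry.
Qed.

Lemma integrable_noise_pdf P (A : set (n.-tuple R)) : 0 < P -> measurable A ->
  (lebesgue_tuple n).-integrable A (fun x => (noise_pdf P x)%:E).
Proof.
move=> P0 mA; apply: (integrableS measurableT) => //.
rewrite (_ : (fun x => _) = fun x : n.-tuple R =>
   (((2 * pi * P) `^ (- (n%:R / 2)))%:E * (expR (- (dot x x / (2 * P))))%:E)%E).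
  by apply: integrableZl => //; apply: integrable_gauss_tuple; exact: mulr_gt0.
by apply/funext => x; rewrite -EFinM /noise_pdf enorm_sqr.
Qed.

(** The density times its logarithmic derivative in [P]. For P > 0 it is negative exactly where
    |x|^2 < nP. *)
Definition dnoise_pdf P x : R :=
  noise_pdf P x * (dot x x / (2 * P ^+ 2) - n%:R / (2 * P)).

Lemma is_derive_noise_pdf P x : 0 < P ->
  is_derive P 1 (fun Q => noise_pdf Q x) (dnoise_pdf P x).
Proof.
move=> P0; set q := dot x x; set a : R := n%:R / 2.
have P2 : P != 0 by rewrite gt_eqF.
have d1 (p : R) : 0 < p -> is_derive P 1 (fun Q : R => (2 * p * Q) `^ (- a))
    ((2 * p * P) `^ (- a) * (- a / P)).
  move=> p0; have pP : 0 < 2 * p * P by rewrite !mulr_gt0.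
  have dl : is_derive P 1 (fun Q : R => 2 * p * Q) (2 * p).
    by apply: is_derive_eq; rewrite /GRing.scale/=; ring.
  apply: (is_derive_eq (is_derive1_comp (is_derive1_powR (- a) pP) dl)).
  rewrite powRD; last by rewrite (gt_eqF pP) implybT.
  rewrite powR_inv1 ?(ltW pP)//; field.
  by rewrite P2 gt_eqF.
have {}d1 := d1 _ (pi_gt0 R).
have d2 : is_derive P 1 (fun Q : R => expR (- (q / (2 * Q))))
    (expR (- (q / (2 * P))) * (q / (2 * P ^+ 2))).
  have dl : is_derive P 1 (fun Q : R => - (q / 2) * Q^-1) (q / (2 * P ^+ 2)).
    have dV := @is_deriveV R (fun Q : R => Q) P 1 1 P2 (is_derive_id _ _).
    by apply: is_derive_eq; rewrite /GRing.scale/=; field.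
  rewrite (_ : (fun Q => _) = expR \o (fun Q : R => - (q / 2) * Q^-1)).
    apply: (is_derive_eq (is_derive1_comp (is_derive_expR _) dl)).
    by congr (expR _ * _); field.
  by apply/funext => Q /=; rewrite invfM mulrA mulNr.
rewrite (_ : (fun Q => _) = fun Q => (2 * pi * Q) `^ (- a) * expR (- (q / (2 * Q)))).
  apply: is_derive_eq; rewrite /GRing.scale/= /dnoise_pdf /noise_pdf enorm_sqr -/q -/a.
  by rewrite (_ : n%:R = a * 2); [field|rewrite /a; field].
by apply/funext => Q; rewrite /noise_pdf enorm_sqr.
Qed.

(* For P / 2 < Q < 2 * P the Gaussian factor is at most e^(-|x|^2/(4P)), the square of
   e^(-|x|^2/(8P)); one of the two copies absorbs the factor |x|^2. *)
Definition dnoise_bound P x : R :=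
  (pi * P) `^ (- (n%:R / 2)) * (16 / P + n%:R / P) * expR (- (dot x x / (8 * P))).

Lemma dnoise_bound_ge0 P x : 0 < P -> 0 <= dnoise_bound P x.
Proof.
by move=> P0; rewrite !mulr_ge0 ?powR_ge0 ?expR_ge0// addr_ge0// divr_ge0// ltW.
Qed.

Lemma integrable_dnoise_bound P (A : set (n.-tuple R)) : 0 < P -> measurable A ->
  (lebesgue_tuple n).-integrable A (fun x => (dnoise_bound P x)%:E).
Proof.
move=> P0 mA; apply: (integrableS measurableT) => //.
rewrite /dnoise_bound; under eq_fun do rewrite EFinM.
by apply: integrableZl => //; apply: integrable_gauss_tuple; exact: mulr_gt0.
Qed.

Lemma dnoise_pdf_le P Q x : 0 < P -> P / 2 < Q < 2 * P ->
  `|dnoise_pdf Q x| <= dnoise_bound P x.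
Proof.
move=> P0 /andP[PQ QP]; have q0 := dotxx_ge0 x.
have Q0 : 0 < Q by apply: lt_trans PQ; rewrite divr_gt0.
rewrite /dnoise_pdf /dnoise_bound /noise_pdf enorm_sqr; set q := dot x x in q0 *.
rewrite normrM ger0_norm ?mulr_ge0 ?powR_ge0 ?expR_ge0//.
rewrite -!mulrA; apply: ler_pM; rewrite ?powR_ge0 ?mulr_ge0 ?expR_ge0//.
  (* The normalizing constants compare because 2Q > P. *)
  rewrite !powRN lef_pV2 ?posrE ?powR_gt0 ?mulr_gt0 ?pi_gt0//.
  apply: ge0_ler_powR; rewrite ?nnegrE ?mulr_ge0 ?pi_ge0 ?invr_ge0 ?(ltW P0) ?(ltW Q0)//.
  by rewrite [2 * _]mulrC -mulrA ler_pM2l ?pi_gt0//; lra.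
set E := expR (- (q / (8 * P))).
have E1 : E <= 1 by rewrite -expR0 ler_expR lerNl oppr0 divr_ge0// mulr_ge0// ltW.
have E0 : 0 <= E by exact: expR_ge0.
have EE : expR (- (q / (2 * Q))) <= E * E.
  rewrite -expRD ler_expR -opprD lerN2.
  rewrite (_ : _ + _ = q / (4 * P)); last by field; rewrite gt_eqF.
  by rewrite ler_wpM2l// lef_pV2 ?posrE ?mulr_gt0//; lra.
(* From y <= 1 + y <= e^y with y = q / (8P). *)
have qE : q * E <= 8 * P.
  rewrite /E expRN -ler_pdivlMr ?invr_gt0 ?expR_gt0// invrK.
  rewrite mulrC -ler_pdivrMr ?mulr_gt0//.
  by apply: le_trans (expR_ge1Dx _); rewrite lerDr.
(* Here Q > P/2 is used, as 1/(2Q^2) <= 2/P^2 and 1/(2Q) <= 1/P. *)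
have B : `|q / (2 * Q ^+ 2) - n%:R / (2 * Q)| <= 2 * q / P ^+ 2 + n%:R / P.
  apply: (le_trans (ler_normB _ _)).
  rewrite !ger0_norm ?divr_ge0 ?mulr_ge0 ?sqr_ge0 ?(ltW Q0)//.
  apply: lerD.
    rewrite [2 * q]mulrC -mulrA ler_wpM2l// -[leRHS]invrK lef_pV2 ?posrE
      ?mulr_gt0 ?exprn_gt0//; last first.
      by rewrite invf_div divr_gt0// exprn_gt0.
    rewrite invf_div.
    have : (P / 2) ^+ 2 <= Q ^+ 2 by rewrite lerXn2r ?nnegrE ?divr_ge0 ?ltW.
    rewrite expr_div_n; lra.
  by rewrite ler_wpM2l// lef_pV2 ?posrE ?mulr_gt0//; lra.
apply: le_trans (ler_pM (expR_ge0 _) (normr_ge0 _) EE B) _.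
(* After one copy of E is set aside, the other turns 2q/P^2 into at most 2 (8P)/P^2 = 16/P, and is
   bounded by 1 in the term n/P. *)
rewrite (mulrC (16 / P + _)) -(mulrA E E); apply: ler_wpM2l => //; rewrite mulrDr lerD//.
  rewrite [2 * q]mulrC -mulrA mulrA [E * q]mulrC.
  apply: le_trans (ler_wpM2r _ qE) _; first by rewrite divr_ge0// sqr_ge0.
  by rewrite le_eqVlt; apply/orP; left; apply/eqP; field; rewrite gt_eqF.
by rewrite ler_piMl// divr_ge0// ltW.
Qed.

End pdf.

(** * Noise mass of a region: monotonicity and derivative in the noise power *)

Section mass.
Context {R : realType} (n : nat).
Implicit Types (P : R) (A : set (n.-tuple R)).

Definition noise_mass A P : R := \int[lebesgue_tuple n]_(x in A) noise_pdf P x.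

Lemma noise_massE A P : 0 < P -> measurable A ->
  (noise_mass A P)%:E = (\int[lebesgue_tuple n]_(x in A) (noise_pdf P x)%:E)%E.
Proof.
move=> P0 mA; rewrite /noise_mass /Rintegral fineK//.
by apply: integrable_fin_num => //; exact: integrable_noise_pdf.
Qed.

Lemma measurable_preimage_scale A (c : R) : measurable A -> measurable (tuple_scale c @^-1` A).
Proof. by move=> mA; rewrite -[X in measurable X]setTI; exact: measurable_tuple_scale. Qed.

Lemma noise_mass_scale A P : 0 < P -> measurable A ->
  noise_mass A P = noise_mass (tuple_scale (Num.sqrt P) @^-1` A) 1.
Proof.
move=> P0 mA; apply: EFin_inj; have sP : 0 < Num.sqrt P by rewrite sqrtr_gt0.
have msA := measurable_preimage_scale (Num.sqrt P) mA.
have mpdf (Q : R) (B : set (n.-tuple R)) : measurable_fun B (fun x => (noise_pdf Q x)%:E).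
  by apply/measurable_EFinP/measurable_funTS; exact: measurable_noise_pdf.
have mr : measurable_fun setT ((fun x => (noise_pdf P x)%:E) \_ A).
  by apply/(measurable_restrictT _ mA); exact: mpdf.
rewrite !noise_massE// integral_mkcond [RHS]integral_mkcond.
rewrite (ge0_integral_tuple_scale sP)//; last first.
  by apply: erestrict_ge0 => x _; rewrite lee_fin noise_pdf_ge0.
rewrite -ge0_integralZl//; last 2 first.
- exact: (measurableT_comp mr (@measurable_tuple_scale R n _)).
- by move=> x _; apply: erestrict_ge0 => y _; rewrite lee_fin noise_pdf_ge0.
apply: eq_integral => x _; rewrite !patchE.
rewrite (_ : (x \in _) = (tuple_scale (Num.sqrt P) x \in A)); last first.
  by apply/idP/idP => /set_mem xA; exact/mem_set.
case: ifP => _; last by rewrite mule0.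
rewrite -EFinM /noise_pdf !enorm_sqr dotxx_scale sqr_sqrtr ?(ltW P0)// !mulr1; congr EFin.
have -> : P * dot x x / (2 * P) = dot x x / 2 by field; rewrite gt_eqF.
(* What remains is that the Jacobian sqrt(P)^n cancels the factor P^(-n/2) of the normalizing
   constant. *)
rewrite mulrA; congr (_ * _).
rewrite powRM ?mulr_ge0 ?pi_ge0 ?(ltW P0)// mulrCA [X in _ * (_ * X)]powRN -powR12_sqrt ?(ltW P0)//.
rewrite -powR_mulrn ?powR_ge0// -powRrM [2^-1 * _]mulrC mulfV ?mulr1//.
by rewrite gt_eqF// powR_gt0.
Qed.

(** After rescaling, both masses are taken at noise power 1 and only the regions differ. If sqrt(Q)
    x lies in A, contracting by sqrt(P)/sqrt(Q) <= 1 puts sqrt(P) x in A, so the region for Q is the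
    smaller one. *)
Lemma noise_mass_le A P Q : measurable A ->
  (forall (c : R) x, 0 < c -> c <= 1 -> A x -> A (tuple_scale c x)) ->
  0 < P -> P <= Q -> noise_mass A Q <= noise_mass A P.
Proof.
move=> mA starA P0 PQ; have Q0 := lt_le_trans P0 PQ.
have sP0 : 0 < Num.sqrt P by rewrite sqrtr_gt0.
have sQ0 : 0 < Num.sqrt Q by rewrite sqrtr_gt0.
rewrite (noise_mass_scale P0 mA) (noise_mass_scale Q0 mA) -lee_fin !noise_massE//;
  [|exact: measurable_preimage_scale..].
apply: ge0_subset_integral; [exact: measurable_preimage_scale..| | |].
- by apply/measurable_EFinP/measurable_funTS; exact: measurable_noise_pdf.
- by move=> x _; rewrite lee_fin noise_pdf_ge0.
- move=> x /= AQ.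
  have -> : tuple_scale (Num.sqrt P) x =
      tuple_scale (Num.sqrt P / Num.sqrt Q) (tuple_scale (Num.sqrt Q) x).
    by apply: eq_from_tnth => i; rewrite !tnth_map mulrA divfK// gt_eqF.
  apply: starA => //; first exact: divr_gt0.
  by rewrite ler_pdivrMr// mul1r ler_wsqrtr.
Qed.

(** Differentiation under the integral sign on the window ]P/2, 2P[, which stays away from 0 and on
    which [dnoise_bound P] dominates the derivative. *)
Let noise_mass_deriv A P : 0 < P -> measurable A ->
  derivable (noise_mass A) P 1 /\
  derive1 (noise_mass A) P = \int[lebesgue_tuple n]_(x in A) dnoise_pdf P x.
Proof.
move=> P0 mA.
have IP : `]P / 2, 2 * P[%classic P by rewrite /= in_itv/=; apply/andP; split; lra.
have I0 (Q : R) : `]P / 2, 2 * P[%classic Q -> 0 < Q.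
  by rewrite /= in_itv/= => /andP[PQ _]; apply: lt_trans PQ; rewrite divr_gt0.
have dE (Q : R) x : 0 < Q -> partial1of2 (@noise_pdf R n) Q x = dnoise_pdf Q x.
  move=> Q0; rewrite partial1of2E; have ? := is_derive_noise_pdf x Q0.
  exact: derive_val.
have intf (Q : R) : `]P / 2, 2 * P[%classic Q ->
    (lebesgue_tuple n).-integrable A (EFin \o noise_pdf Q).
  by move=> /I0 Q0; exact: integrable_noise_pdf.
have derf (Q : R) (x : n.-tuple R) : `]P / 2, 2 * P[%classic Q -> A x ->
    derivable ((@noise_pdf R n) ^~ x) Q 1.
  by move=> /I0 Q0 _; have ? := is_derive_noise_pdf x Q0; exact: ex_derive.
have bound (Q : R) (x : n.-tuple R) : `]P / 2, 2 * P[%classic Q -> A x ->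
    `|partial1of2 (@noise_pdf R n) Q x| <= dnoise_bound P x.
  move=> IQ _; rewrite dE; last exact: I0.
  by apply: dnoise_pdf_le => //; move: IQ; rewrite /= in_itv/=.
have G0 (x : n.-tuple R) : 0 <= dnoise_bound P x by exact: dnoise_bound_ge0.
have intG := integrable_dnoise_bound P0 mA.
split; first exact: (derivable_under_integral mA IP intf derf G0 intG bound).
rewrite (differentiation_under_integral mA IP intf derf G0 intG bound).
by apply: eq_Rintegral => x _; exact: dE.
Qed.

Lemma derivable_noise_mass A P : 0 < P -> measurable A -> derivable (noise_mass A) P 1.
Proof. by move=> P0 mA; have [] := noise_mass_deriv P0 mA. Qed.

Lemma derive1_noise_mass A P : 0 < P -> measurable A ->
  derive1 (noise_mass A) P = \int[lebesgue_tuple n]_(x in A) dnoise_pdf P x.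
Proof. by move=> P0 mA; have [] := noise_mass_deriv P0 mA. Qed.

Lemma measurable_dnoise_pdf P A : measurable_fun A (@dnoise_pdf R n P).
Proof.
apply: measurable_funTS; apply: measurable_funM; first exact: measurable_noise_pdf.
by apply: measurable_funB => //; apply: measurable_funM => //; exact: measurable_dotxx.
Qed.

Lemma integrable_dnoise_pdf P A : 0 < P -> measurable A ->
  (lebesgue_tuple n).-integrable A (fun x => (dnoise_pdf P x)%:E).
Proof.
move=> P0 mA; apply: (le_integrable mA _ _ (integrable_dnoise_bound P0 mA)).
  by apply/measurable_EFinP; exact: measurable_dnoise_pdf.
move=> x _ /=; rewrite lee_fin [leRHS]ger0_norm ?dnoise_bound_ge0//.
by apply: dnoise_pdf_le => //; apply/andP; split; lra.
Qed.

Lemma derive1_noise_mass_ge A P : (0 < n)%N -> 0 < P -> measurable A ->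
  - (cn n / P) <= derive1 (noise_mass A) P.
Proof.
move=> n0 P0 mA; rewrite derive1_noise_mass//.
set a : R := n%:R / 2; have a0 : 0 < a by rewrite divr_gt0// ltr0n.
(* The squared radius [c] is where [dnoise_pdf] changes sign, [r] is the decay rate in |x|^2, and
   [k] below gathers the constants, so that minus [dnoise_pdf] equals k (c - |x|^2) e^(-r|x|^2). *)
pose c : R := n%:R * P; pose r : R := (2 * P)^-1.
have r0 : 0 < r by rewrite invr_gt0 mulr_gt0.
have c0 : 0 < c by rewrite mulr_gt0// ltr0n.
have cr : c * r = a by rewrite /c /r /a; field; rewrite gt_eqF.
have [G0 VE] := @ball_volumeE R n n0.
pose k : R := (2 * pi * P) `^ (- a) / (2 * P ^+ 2).
have k0 : 0 <= k by rewrite divr_ge0 ?powR_ge0// mulr_ge0// sqr_ge0.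
pose g (x : n.-tuple R) : R := Num.max 0 (c - dot x x) * expR (- (r * dot x x)).
have g0 (x : n.-tuple R) : 0 <= g x by rewrite mulr_ge0 ?expR_ge0// le_max lexx.
have mg : measurable_fun setT (fun x : n.-tuple R => (g x)%:E).
  apply/measurable_EFinP/measurable_funM.
    apply: measurable_maxr => //; apply: measurable_funB => //; exact: measurable_dotxx.
  apply: measurableT_comp => //; apply: measurableT_comp => //.
  by apply: measurable_funM => //; exact: measurable_dotxx.
have gE : (\int[lebesgue_tuple n]_x (g x)%:E)%E =
    (pi `^ a / (a * Gamma a) * (c `^ (a + 1) * expR (- a)))%:E.
  under eq_integral do rewrite -(integral_trunc_density_tail c r).
  rewrite ge0_integral_radial; last 2 first.
  - by apply/measurable_EFinP; exact: measurable_trunc_density.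
  - by move=> t; rewrite lee_fin trunc_density_ge0.
  by rewrite -/(ball_volume n) VE (integral_trunc_density_powR c0 a0 cr).
(* The powers of pi and of 2P cancel; the extra factor c = 2aP in c^(a+1) cancels a and 2P, leaving
   a^a e^(-a) / Gamma(a) times 1/P. *)
have kg : k * (pi `^ a / (a * Gamma a) * (c `^ (a + 1) * expR (- a))) = cn n / P.
  rewrite /k /cn -/a.
  have -> : (2 * pi * P) `^ (- a) = (pi `^ a * (2 * P) `^ a)^-1.
    by rewrite powRN [2 * pi]mulrC -mulrA powRM ?pi_ge0// mulr_ge0// ltW.
  have -> : c `^ (a + 1) = a `^ a * (2 * P) `^ a * (2 * a * P).
    rewrite powRD; last by rewrite (gt_eqF c0) implybT.
    have -> : c = a * (2 * P) by rewrite /c /a; field.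
    rewrite powRr1 ?mulr_ge0 ?(ltW a0) ?(ltW P0)// powRM ?mulr_ge0 ?(ltW a0) ?(ltW P0)//.
    by congr (_ * _); ring.
  have : pi `^ a != 0 :> R by rewrite gt_eqF// powR_gt0// pi_gt0.
  have : (2 * P) `^ a != 0 by rewrite gt_eqF// powR_gt0// mulr_gt0.
  have : Gamma a != 0 by rewrite gt_eqF.
  move: (pi `^ a) ((2 * P) `^ a) (Gamma a) => x y z z0 y0 x0.
  by field; rewrite x0 y0 z0 !gt_eqF.
have Nk x : - dnoise_pdf P x <= k * g x.
  rewrite /dnoise_pdf /noise_pdf enorm_sqr -/a /k /g.
  have -> : r * dot x x = dot x x / (2 * P) by rewrite mulrC.
  set E := expR _; set W := _ `^ _; set q := dot x x.
  have -> : - (W * E * (q / (2 * P ^+ 2) - n%:R / (2 * P))) = W / (2 * P ^+ 2) * ((c - q) * E).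
    by rewrite /c; field; rewrite gt_eqF.
  by apply: ler_wpM2l => //; rewrite ler_wpM2r ?expR_ge0// le_max lexx orbT.
have ikg B : measurable B -> (lebesgue_tuple n).-integrable B (fun x => (k * g x)%:E).
  move=> mB; apply: (integrableS measurableT) => //.
  under eq_fun do rewrite EFinM.
  apply: integrableZl => //; apply/integrableP; split=> //.
  by under eq_integral do rewrite gee0_abs ?lee_fin//; rewrite gE ltry.
rewrite lerNl -kg -lee_fin [X in (_ <= X)%E]EFinM -gE.
rewrite -ge0_integralZl//; last by move=> x _; rewrite lee_fin.
have iD := integrable_dnoise_pdf P0 mA.
rewrite -mulN1r -RintegralZl// /Rintegral fineK; last first.
  apply: integrable_fin_num => //; under eq_fun do rewrite EFinM.
  exact: integrableZl.
(* First the integrand is replaced by its positive part on A, then A is enlarged to R^n. *)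
apply: (@le_trans _ _ (\int[lebesgue_tuple n]_(x in A) (k * g x)%:E)%E).
  apply: le_integral => //; [|exact: ikg|].
    by under eq_fun do rewrite EFinM; exact: integrableZl.
  by move=> x _; rewrite lee_fin mulN1r.
apply: ge0_subset_integral => //.
- by have /integrableP[] := ikg _ measurableT.
- by move=> x _; rewrite lee_fin mulr_ge0.
Qed.

End mass.

(** The derivative is also the limit of right-hand difference quotients. Using only b > a keeps
    every noise power positive in the application. *)
Lemma derive1_le0 (R : realType) (f : R -> R) (a : R) : derivable f a 1 ->
  (forall b, a < b -> f b <= f a) -> derive1 f a <= 0.
Proof.
move=> df fa.
have : h^-1 * (f (h + a) - f a) @[h --> 0^'+] --> derive1 f a.
  rewrite derive1E; apply: cvg_dnbhs_at_right.
  move: df; rewrite /derivable /derive => /cvg_toP.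
  by under eq_fun do rewrite scaler1; apply.
move=> /cvgr_to_le; apply.
near=> h; have h0 : 0 < h by near: h; exact: nbhs_right_gt.
by rewrite pmulr_rle0 ?invr_gt0// subr_le0 fa// ltrDr.
Unshelve. all: by end_near. Qed.

(** * Decision regions and the symbol error rate *)

Section decision_region.
Context {R : realType} (n M : nat) (s : 'I_M -> n.-tuple R).

Lemma measurable_decision_region i : measurable (decision_region s i).
Proof.
rewrite (_ : decision_region s i = \bigcap_(j in [set j | j != i])
   [set x | dot (vsub (s j) (s i)) x <= 2^-1 * enorm (vsub (s j) (s i)) ^+ 2]).
  apply: fin_bigcap_measurable; first exact: finite_finset.
  move=> j _; rewrite -[X in measurable X]setTI.
  by apply: measurable_fun_le => //; exact: measurable_dot.
by apply/seteqP; split.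
Qed.

(** Each half-space defining the region has a nonnegative bound, hence contains the origin, and is
    preserved by contractions towards it. *)
Lemma decision_region_star i (c : R) x : 0 < c -> c <= 1 ->
  decision_region s i x -> decision_region s i (tuple_scale c x).
Proof.
move=> c0 c1 sx j ji; rewrite dot_scale.
apply: le_trans (ler_wpM2l (ltW c0) (sx j ji)) _.
by rewrite ler_piMl// mulr_ge0// ?invr_ge0// sqr_ge0.
Qed.

End decision_region.

Theorem theorem8 (R : realType) (n M : nat) (s : 'I_M -> n.-tuple R)
    (prior : 'I_M -> R)
    (n_ge1 : (1 <= n)%N) (M_ge2 : (2 <= M)%N)
    (s_constellation : constellation s) (prior_prob : is_prior prior)
    (P_N : R) (P_N_gt0 : 0 < P_N) :
  derivable (symbol_error_rate s prior) P_N 1 /\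
  0 <= derive1 (symbol_error_rate s prior) P_N <= cn n / P_N.
Proof.
have mD i := measurable_decision_region s i.
have [prior_ge0 prior_sum] := prior_prob.
pose d i : R := derive1 (Pc s i) P_N.
(* [Pc s i] unfolds to the [noise_mass] of the decision region, so the results on masses apply to it
   directly. *)
have dP i : is_derive P_N 1 (Pc s i) (d i).
  by rewrite /d derive1E; apply: derivableP; exact: derivable_noise_mass.
have d0 i : d i <= 0.
  apply: derive1_le0 => [|Q PQ]; first exact: derivable_noise_mass.
  by apply: noise_mass_le => //; [exact: decision_region_star|exact: ltW].
have dn i : - d i <= cn n / P_N.
  by rewrite lerNl; exact: derive1_noise_mass_ge.
have dSER : is_derive P_N 1 (symbol_error_rate s prior) (\sum_(i < M) - d i * prior i).
  rewrite (_ : symbol_error_rate s prior = \sum_(i < M) (fun P => (1 - Pc s i P) * prior i)).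
    apply: is_derive_sum => i.
    by apply: is_derive_eq; rewrite /GRing.scale/=; ring.
  by rewrite fct_sumE.
split; first exact: ex_derive.
rewrite derive1E derive_val; apply/andP; split.
  by apply: sumr_ge0 => i _; rewrite mulr_ge0// oppr_ge0.
(* Since the priors sum to 1, the bound is itself a weighted sum and can be compared term by
   term. *)
rewrite -[leRHS]mulr1 -prior_sum mulr_sumr.
by apply: ler_sum => i _; rewrite ler_wpM2r.
Qed.
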